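(* For each $n\ge1$ consider the family, indexed by $\eta\in\mathbb N$, of two-sided queueing systems with $n$ customer types and $n$ server types on the complete bipartite graph, with identical inverse demand curves $F_j=F$ and identical inverse supply curves $G_i=G$ for all types ($F,G$ not depending on $n$), and all unit waiting costs equal to $1$. Let $\lambda^\star=\mu^\star>0$ be the common per-type fluid-optimal rate. Consider a symmetric pricing policy $$\lambda_j^\eta(\mathbf q)=\eta\lambda^\star+f\!\left(\frac{z(\mathbf q)}{\eta^\alpha}\right)\eta^\beta\ (\forall j),\qquad \mu_i^\eta(\mathbf q)=\eta\mu^\star+g\!\left(\frac{z(\mathbf q)}{\eta^\alpha}\right)\eta^\beta\ (\forall i),\qquad z(\mathbf q)=\sum_jq_j^{(c)}-\sum_iq_i^{(s)},$$ with $0\le\alpha\le1$, $0<\beta<1$, where: (a) there is a constant $\Gamma$, which may depend on $n$ but not on $\eta$, with $|f(x)|\le\Gamma$ and $|g(x)|\le\Gamma$ for all $x\in\mathbb R$; (b) $0<\alpha+\beta<1$; (c) there are constants $\kappa,\delta>0$ (with $\delta$ not depending on $n$) such that if $x>\kappa$ then either $f(x)<-\delta\Gamma$ or $g(x)>\delta\Gamma$, and if $x<-\kappa$ then either $f(x)>\delta\Gamma$ or $g(x)<-\delta\Gamma$. Then under any such symmetric pricing policy and any matching policy (for which the system is stable), $$\liminf_{\eta\to\infty}\frac{L^\eta}{\eta^{1/3}}=\Omega(n^{1/3}),$$ i.e. the left side is at least $c\,n^{1/3}$ for a constant $c>0$ independent of $n$.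
   Context: **Model.** $N$ is a set of $n$ server types, $M$ a set of $m$ customer types (here $m=n$), $E\subseteq N\times M$ the set of compatible pairs (here $E=N\times M$). The state $\mathbf q=(q^{(c)}_j,j\in M;\ q^{(s)}_i,i\in N)\in\mathbb Z_+^{m+n}$ records the numbers of waiting customers and servers of each type. In state $\mathbf q$, type-$j$ customers arrive at Poisson rate $\lambda_j(\mathbf q)\ge0$ and type-$i$ servers at Poisson rate $\mu_i(\mathbf q)\ge0$, chosen by the operator (pricing). **Matching.** A (stationary) matching policy chooses in each state $\mathbf q$ a matching $\mathbf y\in\mathbb Z_+^{nm}$ with $\sum_iy_{ij}\le q_j^{(c)}$, $\sum_jy_{ij}\le q_i^{(s)}$, $y_{ij}=0$ for $(i,j)\notin E$; with $x_j^{(c)}=\sum_iy_{ij}$, $x_i^{(s)}=\sum_jy_{ij}$, the next arrival moves the state from $\mathbf q$ to $\mathbf q+\mathbf e-\mathbf x$, where $\mathbf e$ is the unit vector of the arriving type (matched pairs leave). **Stability.** A pricing and matching policy is stable if the induced continuous-time Markov chain has a positive recurrent communicating class containing the state $\mathbf e_j^{(c)}$ (one type-$j$ customer, nothing else) for some $j\in M$. **Curves.** $F$ is strictly decreasing, $G$ is strictly increasing; both are nonnegative and twice continuously differentiable on the range of feasible rates, $\lambda\mapsto\lambda F(\lambda)$ has strictly negative second derivative, $\mu\mapsto\mu G(\mu)$ has strictly positive second derivative. **Fluid problem.** $\gamma^*=\max\sum_j\lambda_jF(\lambda_j)-\sum_i\mu_iG(\mu_i)$ over $\boldsymbol\lambda,\boldsymbol\mu,\boldsymbol\chi$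 subject to $\lambda_j=\sum_i\chi_{ij}$, $\mu_i=\sum_j\chi_{ij}$, $\chi_{ij}\ge0$. By symmetry the optimal rates are $\lambda_j=\lambda^\star$, $\mu_i=\mu^\star$ with $\lambda^\star=\mu^\star$, assumed positive. **Scaling.** The $\eta$-th system has curves $F^\eta(\eta\lambda)=F(\lambda)$, $G^\eta(\eta\mu)=G(\mu)$; its fluid optimum is $\eta\gamma^*$. **Profit loss.** With $\mathbb E$ the stationary expectation, $$L^\eta=\eta\gamma^*-\Big(\mathbb E\Big[\sum_j\lambda_j(\mathbf q)F^\eta(\lambda_j(\mathbf q))-\sum_i\mu_i(\mathbf q)G^\eta(\mu_i(\mathbf q))\Big]-\sum_j\mathbb E[q_j^{(c)}]-\sum_i\mathbb E[q_i^{(s)}]\Big)$$ (equal to $+\infty$ if some expected queue length is infinite). *)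

(* Defs.v *)
From HB Require Import structures.
From mathcomp Require Import all_boot all_order all_algebra.
From mathcomp Require Import all_classical all_reals all_analysis.

Set Implicit Arguments.
Unset Strict Implicit.
Unset Printing Implicit Defensive.

Import Order.TTheory GRing.Theory Num.Theory.
Import numFieldNormedType.Exports.
Local Open Scope classical_set_scope.
Local Open Scope ring_scope.

(** ** Continuous-time Markov chains with jump intensities [Q x y], [x != y]

    The diagonal values of [Q] are never used. *)

Definition exit_rate (R : realType) (T : choiceType) (Q : T -> T -> R)
    (x : T) : R :=
  fine (\esum_(y in [set~ x]) (Q x y)%:E).

Definition jump_prob (R : realType) (T : choiceType) (Q : T -> T -> R)
    (x y : T) : R :=
  if y == x then 0 else Q x y / exit_rate Q x.

Definition communicating_class (R : realType) (T : choiceType)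
    (Q : T -> T -> R) (x : T) : set T :=
  let leads_to a b :=
    exists s : seq T, path (fun u v => 0 < Q u v) a s /\ last a s = b in
  [set y | leads_to x y /\ leads_to y x].

(* Probability that the embedded jump chain started at [x] is at [y] after [k]
   jumps and has not come back to [x] during the jumps 1, ..., k. *)
Fixpoint taboo_prob (R : realType) (T : choiceType) (Q : T -> T -> R)
    (x : T) (k : nat) (y : T) : \bar R :=
  match k with
  | 0%N => ((y == x)%:R)%:E
  | k'.+1 =>
      if y == x then 0%E
      else (\esum_(w in [set: T]) (taboo_prob Q x k' w * (jump_prob Q w y)%:E))%E
  end.

Definition return_prob (R : realType) (T : choiceType) (Q : T -> T -> R)
    (x : T) : \bar R :=
  (\sum_(0 <= k <oo)
    \esum_(w in [set: T]) (taboo_prob Q x k w * (jump_prob Q w x)%:E))%E.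

(* On the event of return, the return time is the sum of the holding times
   preceding it; the holding time at [y] has mean [(exit_rate Q y)^-1]. *)
Definition mean_return_time (R : realType) (T : choiceType) (Q : T -> T -> R)
    (x : T) : \bar R :=
  (\sum_(0 <= k <oo)
    \esum_(y in [set: T]) (taboo_prob Q x k y * ((exit_rate Q y)^-1)%:E))%E.

(* The first disjunct is the usual convention for absorbing states. *)
Definition positive_recurrent (R : realType) (T : choiceType)
    (Q : T -> T -> R) (x : T) : Prop :=
  exit_rate Q x = 0 \/
  (return_prob Q x = 1%E /\ (mean_return_time Q x < +oo)%E).

Definition positive_recurrent_class (R : realType) (T : choiceType)
    (Q : T -> T -> R) (C : set T) : Prop :=
  (exists x, C = communicating_class Q x) /\
  (forall x, C x -> positive_recurrent Q x).

Definition stationary_distribution (R : realType) (T : choiceType)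
    (Q : T -> T -> R) (C : set T) (pi : T -> R) : Prop :=
  [/\ forall x, 0 <= pi x,
      forall x, ~ C x -> pi x = 0,
      (\esum_(x in [set: T]) (pi x)%:E)%E = 1%E
    & forall y, (\esum_(x in [set~ y]) (pi x * Q x y)%:E)%E
                = (pi y * exit_rate Q y)%:E].

Definition expectation_of (R : realType) (T : choiceType) (pi phi : T -> R)
    : \bar R :=
  let w := fun x => (pi x * phi x)%:E in
  (\esum_(x in [set: T]) w^\+ x - \esum_(x in [set: T]) w^\- x)%E.

(** ** The two-sided queue with [n] customer types and [n] server types on the
    complete bipartite graph *)

(* [q.1 j]: waiting customers of type [j]; [q.2 i]: waiting servers of type [i]. *)
Definition state (n : nat) : Type :=
  ({ffun 'I_n -> nat} * {ffun 'I_n -> nat})%type.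
HB.instance Definition _ (n : nat) := Countable.copy (state n)
  ({ffun 'I_n -> nat} * {ffun 'I_n -> nat})%type.

Definition single_customer (n : nat) (j : 'I_n) : state n :=
  ([ffun k => nat_of_bool (k == j)], [ffun=> 0%N]).

Definition imbalance (R : realType) (n : nat) (q : state n) : R :=
  \sum_(j < n) (q.1 j)%:R - \sum_(i < n) (q.2 i)%:R.

(* Rows of a matching are server types, columns are customer types. *)
Definition matching_policy (n : nat) (y : state n -> 'M[nat]_n) : Prop :=
  forall q : state n,
    (forall j, (\sum_(i < n) y q i j <= q.1 j)%N) /\
    (forall i, (\sum_(j < n) y q i j <= q.2 i)%N).

Definition after_customer (n : nat) (y : state n -> 'M[nat]_n) (q : state n)
    (j : 'I_n) : state n :=
  ([ffun k => (q.1 k - \sum_(i < n) y q i k + (k == j))%N],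
   [ffun k => (q.2 k - \sum_(l < n) y q k l)%N]).

Definition after_server (n : nat) (y : state n -> 'M[nat]_n) (q : state n)
    (i : 'I_n) : state n :=
  ([ffun k => (q.1 k - \sum_(l < n) y q l k)%N],
   [ffun k => (q.2 k - \sum_(j < n) y q k j + (k == i))%N]).

Definition queue_intensity (R : realType) (n : nat)
    (lam mu : state n -> 'I_n -> R) (y : state n -> 'M[nat]_n)
    (q q' : state n) : R :=
  \sum_(j < n | q' == after_customer y q j) lam q j +
  \sum_(i < n | q' == after_server y q i) mu q i.

Definition stable_class (R : realType) (n : nat)
    (Q : state n -> state n -> R) (C : set (state n)) : Prop :=
  positive_recurrent_class Q C /\ exists j, C (single_customer j).

(** ** Demand and supply curves *)

(* Derivative relative to [D], one-sided at the endpoints belonging to [D]. *)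
Definition derivative_on (R : realType) (D : set R) (h h' : R -> R) : Prop :=
  forall x, D x -> (h y - h x) / (y - x) @[y --> within D x^'] --> h' x.

Definition twice_continuously_differentiable_on (R : realType) (D : set R)
    (h : R -> R) : Prop :=
  exists h1 h2 : R -> R,
    [/\ derivative_on D h h1, derivative_on D h1 h2
      & {within D, continuous h2}].

Definition second_derivative_on (R : realType) (D : set R) (h h2 : R -> R)
    : Prop :=
  exists h1 : R -> R, derivative_on D h h1 /\ derivative_on D h1 h2.

Definition rate_range (R : realType) (D : set R) : Prop :=
  [/\ is_interval D, forall x, D x -> 0 <= x
    & exists a b, [/\ D a, D b & a < b]].

Definition inverse_demand_curve (R : realType) (D : set R) (F : R -> R)
    : Prop :=
  [/\ forall x y, D x -> D y -> x < y -> F y < F x,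
      forall x, D x -> 0 <= F x,
      twice_continuously_differentiable_on D F
    & exists2 h2, second_derivative_on D (fun x => x * F x) h2
                & forall x, D x -> h2 x < 0].

Definition inverse_supply_curve (R : realType) (D : set R) (G : R -> R)
    : Prop :=
  [/\ forall x y, D x -> D y -> x < y -> G x < G y,
      forall x, D x -> 0 <= G x,
      twice_continuously_differentiable_on D G
    & exists2 h2, second_derivative_on D (fun x => x * G x) h2
                & forall x, D x -> 0 < h2 x].

(** ** Fluid problem *)

Definition profit_rate (R : realType) (n : nat) (F G : R -> R)
    (lam mu : 'I_n -> R) : R :=
  \sum_(j < n) lam j * F (lam j) - \sum_(i < n) mu i * G (mu i).

Definition fluid_feasible (R : realType) (n : nat) (DF DG : set R)
    (lam mu : 'I_n -> R) : Prop :=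
  [/\ forall j, DF (lam j), forall i, DG (mu i)
    & exists chi : 'M[R]_n,
        [/\ forall i j, 0 <= chi i j,
            forall j, lam j = \sum_(i < n) chi i j
          & forall i, mu i = \sum_(j < n) chi i j]].

Definition fluid_optimal (R : realType) (n : nat) (DF DG : set R)
    (F G : R -> R) (lam mu : 'I_n -> R) : Prop :=
  fluid_feasible DF DG lam mu /\
  forall lam' mu' : 'I_n -> R, fluid_feasible DF DG lam' mu' ->
    profit_rate F G lam' mu' <= profit_rate F G lam mu.

Definition fluid_value (R : realType) (n : nat) (DF DG : set R)
    (F G : R -> R) : R :=
  sup [set v | exists lam mu : 'I_n -> R,
                 fluid_feasible DF DG lam mu /\ v = profit_rate F G lam mu].

(** ** Scaling, policies and profit loss *)

(* The curve [H^eta] determined by [H^eta (eta * x) = H x]. *)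
Definition scaled_curve (R : realType) (eta : nat) (H : R -> R) (x : R) : R :=
  H (x / eta%:R).

Definition symmetric_rate (R : realType) (n : nat) (eta : nat)
    (alpha beta r : R) (h : R -> R) (q : state n) (_ : 'I_n) : R :=
  eta%:R * r + h (imbalance R q / eta%:R `^ alpha) * eta%:R `^ beta.

(* [D] is the unscaled range: the rates of the [eta]-th system lie in [eta * D]. *)
Definition feasible_rates (R : realType) (n : nat) (eta : nat) (D : set R)
    (lam : state n -> 'I_n -> R) : Prop :=
  forall q k, D (lam q k / eta%:R).

Definition profit_loss (R : realType) (n : nat) (DF DG : set R) (F G : R -> R)
    (eta : nat) (lam mu : state n -> 'I_n -> R) (pi : state n -> R) : \bar R :=
  ((eta%:R * fluid_value n DF DG F G)%:E -
   (expectation_of pi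
      (fun q => profit_rate (scaled_curve eta F) (scaled_curve eta G)
                  (lam q) (mu q))
    - \sum_(j < n) expectation_of pi (fun q => (q.1 j)%:R)
    - \sum_(i < n) expectation_of pi (fun q => (q.2 i)%:R)))%E.

(* Main.v *)
Require Import Defs.
From HB Require Import structures.
From mathcomp Require Import all_boot all_order all_algebra.
From mathcomp Require Import all_classical all_reals all_analysis.
From mathcomp Require Import ring lra zify.

Set Implicit Arguments.
Unset Strict Implicit.
Unset Printing Implicit Defensive.

Import Order.TTheory GRing.Theory Num.Theory.
Import numFieldNormedType.Exports.
Local Open Scope classical_set_scope.
Local Open Scope ring_scope.

(** Whatever the matching, the imbalance [z] moves by one at each arrival, with
    rates depending on [z] only, so its stationary law [r] satisfies
    [(L + u k) r k = (L + v (k + 1)) r (k + 1)], where [L = eta lambda^*] and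
    [|u|, |v| <= t = Gamma eta^beta]. Since
    [|r (k + 1) - r k| <= (t / L) (r k + r (k + 1))] and [r] is summable, no value
    of [z] has mass above [2 t / L]. Hence
    [E|z| >= L / (32 t)], which bounds the waiting cost, and, as
    [alpha + beta < 1], the event [|z| > kappa eta^alpha], on which one of the
    rates is off by [delta t], has probability at least 1/2. Strict concavity of
    the fluid problem turns these deviations into a revenue loss of order
    [n (delta t)^2 / eta]; the first-order term vanishes on average because
    demand and supply have equal means. The sum [A t^2 + B / t] of the two
    losses is at least [(A B^2)^(1/3)], which is of order [(n eta)^(1/3)]
    whatever [t]. *)

(** * Concavity and the fluid problem *)

Section derivative_on.
Variable R : realType.
Implicit Types (D : set R) (h : R -> R).

Lemma derivative_onP D h h' x e : derivative_on D h h' -> D x -> 0 < e ->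
  exists2 d, 0 < d & forall y, D y -> y != x -> `|y - x| < d ->
    `|(h y - h x) / (y - x) - h' x| < e.
Proof.
move=> Dh Dx e0; have /cvgrPdist_lt/(_ _ e0) := Dh x Dx.
move=> /nbhs_ballP[d /= d0 dP].
exists d => // y Dy yx yd; rewrite distrC; apply: dP => //.
by rewrite /ball /= distrC.
Qed.

Lemma derivative_onN D h h' :
  derivative_on D h h' -> derivative_on D (fun x => - h x) (fun x => - h' x).
Proof.
move=> Dh x Dx.
under eq_fun do rewrite -opprD mulNr.
exact: cvgN (Dh x Dx).
Qed.

(** Strictly between [u] and [v] the interval [D] contains a neighbourhood, so the relative
    derivative is the usual one there; boundedness of the difference quotients gives continuity up
    to the endpoints. *)
Lemma derivative_on_MVT D h h' u v : is_interval D -> derivative_on D h h' ->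
  D u -> D v -> u < v ->
  exists2 c, u < c < v & h v - h u = h' c * (v - u).
Proof.
move=> Ditv Dh Du Dv uv.
have Dc c : u <= c <= v -> D c by exact: Ditv.
have [||c cuv ->] := @MVT R h h' u v uv; last by exists c => //; rewrite in_itv in cuv.
- move=> x; rewrite in_itv /= => /andP[ux xv].
  have Dx : D x by apply: Dc; rewrite !ltW.
  suff H : (fun k => k^-1 *: (h (k *: 1 + x) - h x)) @ 0^' --> h' x.
    by apply: DeriveDef; [apply/cvg_ex; exists (h' x)|apply: cvg_lim].
  apply/cvgrPdist_lt => e e0.
  have [d d0 dP] := derivative_onP Dh Dx e0.
  near=> k.
  have k0 : k != 0 by near: k; exact: nbhs_dnbhs_neq.
  have kd : `|k| < d by near: k; apply: dnbhs0_lt.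
  have kux : `|k| < x - u by near: k; apply: dnbhs0_lt; rewrite subr_gt0.
  have kvx : `|k| < v - x by near: k; apply: dnbhs0_lt; rewrite subr_gt0.
  have := dP (k + x); rewrite addrK distrC mulrC -[k *: 1]/(k * 1) mulr1; apply=> //.
    apply: Dc; move: kux kvx; rewrite !ltr_norml => /andP[? ?] /andP[? ?].
    by apply/andP; split; lra.
  by rewrite -subr_eq0 addrK.
- apply/subspace_continuousP => x; rewrite /= in_itv /= => /Dc Dx.
  apply/cvgrPdist_lt => e e0.
  have [d d0 dP] := derivative_onP Dh Dx ltr01.
  set K := `|h' x| + 1.
  have K0 : 0 < K by rewrite ltr_wpDl.
  apply/nbhs_ballP; exists (Num.min d (e / K)) => /=; first by rewrite lt_min d0 divr_gt0.
  move=> y; rewrite /ball /= lt_min => /andP[xyd xye].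
  rewrite /= in_itv /= => /Dc Dy.
  have [->|yx] := eqVneq y x; first by rewrite subrr normr0.
  rewrite distrC in xyd.
  have := dP y Dy yx xyd => /ltW /(le_trans (lerB_dist _ _)).
  rewrite lerBlDl normrM normfV ler_pdivrMr ?normr_gt0 ?subr_eq0// => hyx.
  rewrite distrC; apply: le_lt_trans hyx _.
  by rewrite -ltr_pdivlMl// mulrC distrC.
Unshelve. all: by end_near.
Qed.

(* A Taylor bound with Peano remainder: continuity of the second derivative is
   not needed, because the mean value theorem is only applied on the two halves
   of the segment joining [x] and [y]. *)
Lemma strictly_concave_bound D h h1 h2 x : is_interval D ->
  derivative_on D h h1 -> derivative_on D h1 h2 -> D x -> h2 x < 0 ->
  exists2 a, 0 < a & exists2 d, 0 < d & forall y, D y -> `|y - x| < d ->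
    h y <= h x + h1 x * (y - x) - a * (y - x) ^+ 2.
Proof.
move=> Ditv Dh Dh1 Dx hx.
have e0 : 0 < - (h2 x / 2) by lra.
have [d d0 dP] := derivative_onP Dh1 Dx e0.
have r c : D c -> c != x -> `|c - x| < d -> (h1 c - h1 x) / (c - x) < h2 x / 2.
  by move=> Dc cx cd; have := dP c Dc cx cd; rewrite ltr_norml => /andP[_]; lra.
have hr c : D c -> x < c -> c - x < d -> h1 c <= h1 x + h2 x / 2 * (c - x).
  move=> Dc xc cd; have cx0 : 0 < c - x by rewrite subr_gt0.
  have := r c Dc; rewrite gt_eqF// gtr0_norm// => /(_ isT cd).
  by rewrite ltr_pdivrMr//; lra.
have hl c : D c -> c < x -> x - c < d -> h1 x + h2 x / 2 * (c - x) <= h1 c.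
  move=> Dc xc cd; have cx0 : c - x < 0 by rewrite subr_lt0.
  have := r c Dc; rewrite lt_eqF// ltr0_norm// opprB => /(_ isT cd).
  by rewrite ltr_ndivrMr//; lra.
(* On the half of the segment farther from [x], [h1] has moved from [h1 x] by at least [- h2 x / 2]
   times [|y - x| / 2]; this half has length [|y - x| / 2], whence the 8. On the nearer half only
   the sign of [h1 - h1 x] is used. *)
exists (- h2 x / 8); first lra.
exists d => // y Dy.
set m := (x + y) / 2.
have [yx|xy|->] := ltgtP y x; last by rewrite subrr; lra.
- rewrite ltr0_norm ?subr_lt0// opprB => yd.
  have Dm : D m by apply: Ditv Dy Dx _ _; rewrite /m; apply/andP; split; lra.
  have [|c /andP[yc cm] E1] := derivative_on_MVT Ditv Dh Dy Dm; first by rewrite /m; lra.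
  have [|c' /andP[mc cx] E2] := derivative_on_MVT Ditv Dh Dm Dx; first by rewrite /m; lra.
  have Dc : D c by apply: Ditv Dy Dx _ _; apply/andP; split; rewrite /m in cm; lra.
  have Dc' : D c' by apply: Ditv Dy Dx _ _; apply/andP; split; rewrite /m in mc; lra.
  have H1 : h1 x + h2 x / 2 * (m - x) <= h1 c.
    by apply: le_trans (hl _ Dc _ _); rewrite ?/m in cm mc *; nra.
  have H2 : h1 x <= h1 c'.
    by apply: le_trans (hl _ Dc' _ _); rewrite ?/m in cm mc *; nra.
  have M1 := ler_wpM2r (_ : 0 <= m - y) H1.
  have M2 := ler_wpM2r (_ : 0 <= x - m) H2.
  have {}M1 := M1 ltac:(rewrite /m; lra).
  have {}M2 := M2 ltac:(rewrite /m; lra).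
  rewrite -E1 in M1; rewrite -E2 in M2.
  move: M1 M2; rewrite /m; nra.
- rewrite gtr0_norm ?subr_gt0// => yd.
  have Dm : D m by apply: Ditv Dx Dy _ _; rewrite /m; apply/andP; split; lra.
  have [|c' /andP[xc cm] E2] := derivative_on_MVT Ditv Dh Dx Dm; first by rewrite /m; lra.
  have [|c /andP[mc cy] E1] := derivative_on_MVT Ditv Dh Dm Dy; first by rewrite /m; lra.
  have Dc : D c by apply: Ditv Dx Dy _ _; apply/andP; split; rewrite /m in mc; lra.
  have Dc' : D c' by apply: Ditv Dx Dy _ _; apply/andP; split; rewrite /m in cm; lra.
  have H1 : h1 c <= h1 x + h2 x / 2 * (m - x).
    by apply: le_trans (hr _ Dc _ _) _; rewrite ?/m in cm mc *; nra.
  have H2 : h1 c' <= h1 x.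
    by apply: le_trans (hr _ Dc' _ _) _; rewrite ?/m in cm mc *; nra.
  have M1 := ler_wpM2r (_ : 0 <= y - m) H1.
  have M2 := ler_wpM2r (_ : 0 <= m - x) H2.
  have {}M1 := M1 ltac:(rewrite /m; lra).
  have {}M2 := M2 ltac:(rewrite /m; lra).
  rewrite -E1 in M1; rewrite -E2 in M2.
  move: M1 M2; rewrite /m; nra.
Qed.

End derivative_on.

(** * First-order conditions for the per-type profit *)

Section common_maximizer.
Variables (R : realType) (D1 D2 : set R) (P C p c p2 c2 : R -> R).
Hypotheses (D1itv : is_interval D1) (D2itv : is_interval D2).
Hypotheses (Pp : derivative_on D1 P p) (Cc : derivative_on D2 C c).
Hypotheses (pp2 : derivative_on D1 p p2) (cc2 : derivative_on D2 c c2).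
Hypotheses (p2_lt0 : forall x, D1 x -> p2 x < 0).
Hypotheses (c2_gt0 : forall x, D2 x -> 0 < c2 x).

Let maximizer x0 := [/\ D1 x0, D2 x0 &
  forall x, D1 x -> D2 x -> P x - C x <= P x0 - C x0].

(** A short move from [x0] towards [x] stays in both intervals; if the product were positive, it
    would increase [P - C]. *)
Lemma maximizer_first_order x0 x : maximizer x0 -> D1 x -> D2 x ->
  (p x0 - c x0) * (x - x0) <= 0.
Proof.
move=> [D1x0 D2x0 maxx0] D1x D2x; rewrite leNgt; apply/negP => k0.
set k := p x0 - c x0 in k0 *.
have kn0 : k != 0 by apply: contraTneq k0 => ->; rewrite mul0r ltxx.
have xn0 : x - x0 != 0 by apply: contraTneq k0 => ->; rewrite mulr0 ltxx.
have e0 : 0 < `|k| / 2 by rewrite divr_gt0 ?normr_gt0.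
have [d1 d10 h1] := derivative_onP Pp D1x0 e0.
have [d2 d20 h2] := derivative_onP Cc D2x0 e0.
set m := Num.min d1 d2; have m0 : 0 < m by rewrite lt_min d10.
(* This choice gives both [t < 1] and [t * |x - x0| < m]. *)
set t := m / (m + `|x - x0|).
have xp : 0 < `|x - x0| by rewrite normr_gt0.
have mp : 0 < m + `|x - x0| by rewrite addr_gt0.
have t0 : 0 < t by rewrite divr_gt0.
have t1 : t < 1 by rewrite /t ltr_pdivrMr// mul1r ltrDl.
set y := x0 + t * (x - x0).
have yE : y - x0 = t * (x - x0) by rewrite /y addrC addKr.
have yn : y != x0 by rewrite -subr_eq0 yE mulf_neq0// gt_eqF.
have yd : `|y - x0| < m.
  rewrite yE normrM gtr0_norm// /t mulrAC ltr_pdivrMr// ltr_pM2l//.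
  by rewrite ltrDr.
have Dy D : is_interval D -> D x -> D x0 -> D y.
  move=> Ditv Dx Dx0; have [xx0|xx0] := leP x x0.
    by apply: Ditv Dx Dx0 _ _; rewrite /y; apply/andP; split; nra.
  by apply: Ditv Dx0 Dx _ _; rewrite /y; apply/andP; split; nra.
move: yd; rewrite lt_min => /andP[yd1 yd2].
have := h1 y (Dy _ D1itv D1x D1x0) yn yd1; have := h2 y (Dy _ D2itv D2x D2x0) yn yd2.
have := maxx0 y (Dy _ D1itv D1x D1x0) (Dy _ D2itv D2x D2x0).
set qC := (C y - C x0) / _; set qP := (P y - P x0) / _ => maxy hC hP.
have yn0 : y - x0 != 0 by rewrite subr_eq0.
have qCE : C y - C x0 = qC * (y - x0) by rewrite /qC divfK.
have qPE : P y - P x0 = qP * (y - x0) by rewrite /qP divfK.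
(* The difference quotient of [P - C] is closer to [k] than 0 is, so it has the sign of [k]. *)
have : `|(qP - qC) - k| < `|k|.
  rewrite (_ : _ - k = (qP - p x0) - (qC - c x0)); last by rewrite /k; ring.
  by apply: le_lt_trans (ler_normB _ _) _; lra.
have : (qP - qC) * (y - x0) <= 0 by rewrite mulrBl -qCE -qPE; lra.
rewrite yE mulrCA pmulr_rle0// => Hq.
have [kp|kN|k00] := ltgtP 0 k; last by rewrite -k00 eqxx in kn0.
- rewrite (gtr0_norm kp) ltr_norml => /andP[h _].
  rewrite pmulr_rgt0// in k0; have q0 : 0 < qP - qC by lra.
  by move: Hq; rewrite leNgt mulr_gt0.
- rewrite (ltr0_norm kN) ltr_norml => /andP[_ h].
  rewrite nmulr_rgt0// in k0; have q0 : qP - qC < 0 by lra.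
  by move: Hq; rewrite leNgt nmulr_rgt0// k0.
Qed.

(** If [x0 < x1], the first-order conditions give [p - c <= 0] at [x0] and [p - c >= 0] at [x1],
    whereas [p] strictly decreases and [c] strictly increases. *)
Lemma maximizer_unique x0 x1 : maximizer x0 -> maximizer x1 -> x0 = x1.
Proof.
wlog : x0 x1 / x0 < x1 => [wl m0 m1|lt01 m0 m1].
  by have [/wl->|/wl->|//] := ltgtP x0 x1.
have [D1x0 D2x0 _] := m0; have [D1x1 D2x1 _] := m1.
have h0 := maximizer_first_order m0 D1x1 D2x1.
have h1 := maximizer_first_order m1 D1x0 D2x0.
rewrite pmulr_lle0 ?subr_gt0// in h0; rewrite nmulr_lle0 ?subr_lt0// in h1.
have [z /andP[zx0 zx1] Ep] := derivative_on_MVT D1itv pp2 D1x0 D1x1 lt01.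
have [w /andP[wx0 wx1] Ec] := derivative_on_MVT D2itv cc2 D2x0 D2x1 lt01.
have D1z : D1 z by apply: D1itv D1x0 D1x1 _ _; rewrite !ltW.
have D2w : D2 w by apply: D2itv D2x0 D2x1 _ _; rewrite !ltW.
have x01 : 0 < x1 - x0 by rewrite subr_gt0.
have : p x1 - p x0 < 0 by rewrite Ep nmulr_rlt0// p2_lt0.
have : 0 < c x1 - c x0 by rewrite Ec mulr_gt0// c2_gt0.
lra.
Qed.

(** Otherwise some [x] in [D1] and some [u] in [D2] lie on the side of [x0] where [P - C] has an
    upward slope; the nearer of the two belongs to both intervals and contradicts
    [maximizer_first_order]. *)
Let one_sided x0 : maximizer x0 ->
  (forall x, D1 x -> (p x0 - c x0) * (x - x0) <= 0) \/
  (forall u, D2 u -> (p x0 - c x0) * (u - x0) <= 0).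
Proof.
move=> m0; have [D1x0 D2x0 _] := m0.
have [|/existsNP[x /not_implyP[D1x /negP]]] :=
  pselect (forall x, D1 x -> (p x0 - c x0) * (x - x0) <= 0); first by left.
rewrite -ltNge => xk; right => u D2u; rewrite leNgt; apply/negP => uk.
suff : D1 u \/ D2 x.
  by case=> D; [have := maximizer_first_order m0 D D2u|
    have := maximizer_first_order m0 D1x D]; rewrite leNgt ?xk ?uk.
have [k0|k0|k0] := ltgtP 0 (p x0 - c x0); last by rewrite -k0 mul0r ltxx in xk.
- rewrite pmulr_rgt0// subr_gt0 in xk; rewrite pmulr_rgt0// subr_gt0 in uk.
  have [xu|ux] := leP x u; [right|left].
    by apply: D2itv D2x0 D2u _ _; rewrite (ltW xk).
  by apply: D1itv D1x0 D1x _ _; rewrite !ltW.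
- rewrite nmulr_rgt0// subr_lt0 in xk; rewrite nmulr_rgt0// subr_lt0 in uk.
  have [xu|ux] := leP x u; [left|right].
    by apply: D1itv D1x D1x0 _ _; rewrite xu ltW.
  by apply: D2itv D2u D2x0 _ _; rewrite !ltW.
Qed.

(* [s] is a Lagrange multiplier for the constraint that demand and supply have
   equal means; when [x0] is an endpoint of [D1] or [D2] the slopes of [P] and
   [C] may differ, and [s] is the one of the curve that can move both ways. *)
Lemma maximizer_lagrangian_bound x0 : maximizer x0 ->
  exists2 a, 0 < a & exists2 d, 0 < d & exists s, forall x u,
    D1 x -> D2 u -> `|x - x0| < d -> `|u - x0| < d ->
    P x - C u <= P x0 - C x0 + s * (x - u) - a * ((x - x0) ^+ 2 + (u - x0) ^+ 2).
Proof.
move=> m0; have [D1x0 D2x0 _] := m0.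
have [a a0 [d d0 dP]] := strictly_concave_bound D1itv Pp pp2 D1x0 (p2_lt0 D1x0).
have c2N : - c2 x0 < 0 by rewrite oppr_lt0 c2_gt0.
have [b b0 [d' d'0 dC]] := strictly_concave_bound D2itv (derivative_onN Cc)
  (derivative_onN cc2) D2x0 c2N.
exists (Num.min a b); first by rewrite lt_min a0.
exists (Num.min d d'); first by rewrite lt_min d0.
have Hs : exists s, forall x u, D1 x -> D2 u ->
    p x0 * (x - x0) - c x0 * (u - x0) <= s * (x - u).
  case: (one_sided m0) => h.
    by exists (c x0) => x u D1x _; have := h x D1x; lra.
  by exists (p x0) => x u _ D2u; have := h u D2u; lra.
case: Hs => s Hs; exists s => x u D1x D2u; rewrite !lt_min => /andP[xd _] /andP[_ ud].
have := dP x D1x xd; have := dC u D2u ud; have := Hs x u D1x D2u.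
have h1 : Num.min a b * (x - x0) ^+ 2 <= a * (x - x0) ^+ 2.
  by rewrite ler_wpM2r ?sqr_ge0// ge_min lexx.
have h2 : Num.min a b * (u - x0) ^+ 2 <= b * (u - x0) ^+ 2.
  by rewrite ler_wpM2r ?sqr_ge0// ge_min lexx orbT.
by move: h1 h2; lra.
Qed.

End common_maximizer.

(** * Weighted sums *)

Section esum_extra.
Variable R : realType.
Local Open Scope ereal_scope.

Lemma ge0_esumZl (T : choiceType) (A : set T) (r : R) (a : T -> \bar R) :
  (0 <= r)%R -> (forall x, 0 <= a x) ->
  \esum_(x in A) (r%:E * a x) = r%:E * \esum_(x in A) a x.
Proof.
move=> r0 a0; rewrite /esum -ereal_supZl//; last first.
  by apply/set0P; exists (\sum_(x \in set0) a x), set0 => //; exact: fsets_set0.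
congr ereal_sup; apply/seteqP; split => [_ [X AX] <-|_ [_ [X AX <-] <-]].
  by exists (\sum_(x \in X) a x); [exists X|rewrite ge0_mule_fsumr].
by exists X => //; rewrite ge0_mule_fsumr.
Qed.

Lemma esum_exchange (T U : choiceType) (a : T -> U -> \bar R) :
  (forall x y, 0 <= a x y) ->
  \esum_(x in [set: T]) \esum_(y in [set: U]) a x y =
  \esum_(y in [set: U]) \esum_(x in [set: T]) a x y.
Proof.
move=> a0; rewrite esum_esum// esum_esum//.
apply: (@reindex_esum _ _ _ _ _ (fun k : U * T => (k.2, k.1))); split.
- by move=> [].
- by move=> [? ?] [? ?] _ _ [-> ->].
- by move=> [x y] _; exists (y, x).
Qed.

Lemma esum_if_eq (T : choiceType) (t : T) (a : T -> \bar R) :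
  0 <= a t -> \esum_(x in [set: T]) (if x == t then a x else 0) = a t.
Proof.
move=> at0; rewrite -[RHS](esum_set1 at0) [RHS]esum_mkcond.
apply: eq_esum => x _.
by have -> : (x \in [set t]) = (x == t) by apply/idP/eqP; rewrite inE.
Qed.

End esum_extra.

Section weighted_sum.
Variables (R : realType) (T : choiceType) (pi : T -> R).
Hypothesis pi_ge0 : forall x, 0 <= pi x.
Hypothesis pi_sum1 : \esum_(x in [set: T]) (pi x)%:E = 1%E.

(** For nonnegative [phi] this agrees with [expectation_of]; as a single sum in [\bar R] it can then
    be split and exchanged even when infinite. *)
Definition wsum (phi : T -> R) : \bar R :=
  \esum_(x in [set: T]) (pi x * phi x)%:E.

Lemma wsum_ge0 phi : (forall x, 0 <= phi x) -> (0 <= wsum phi)%E.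
Proof. by move=> p0; apply: esum_ge0 => x _; rewrite lee_fin mulr_ge0. Qed.

Lemma le_wsum phi psi : (forall x, phi x <= psi x) -> (wsum phi <= wsum psi)%E.
Proof. by move=> h; apply: le_esum => x _; rewrite lee_fin ler_wpM2l. Qed.

Lemma eq_wsum phi psi : phi =1 psi -> wsum phi = wsum psi.
Proof. by move=> h; apply: eq_esum => x _; rewrite h. Qed.

Lemma wsumD phi psi : (forall x, 0 <= phi x) -> (forall x, 0 <= psi x) ->
  wsum (fun x => phi x + psi x) = (wsum phi + wsum psi)%E.
Proof.
move=> p0 q0; rewrite /wsum -esumD; first by apply: eq_esum => x _; rewrite mulrDr EFinD.
all: by move=> x _; rewrite lee_fin mulr_ge0.
Qed.

Lemma wsumZ k phi : 0 <= k -> (forall x, 0 <= phi x) ->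
  wsum (fun x => k * phi x) = (k%:E * wsum phi)%E.
Proof.
move=> k0 p0; rewrite /wsum -ge0_esumZl//.
  by apply: eq_esum => x _; rewrite mulrCA EFinM.
by move=> x; rewrite lee_fin mulr_ge0.
Qed.

Lemma wsum_cst k : 0 <= k -> wsum (fun=> k) = k%:E.
Proof.
move=> k0; rewrite -[RHS]mule1 -pi_sum1 -ge0_esumZl//.
by apply: eq_esum => x _; rewrite mulrC.
Qed.

Lemma wsum_fin_num k phi : (forall x, 0 <= phi x) -> (forall x, phi x <= k) ->
  wsum phi \is a fin_num.
Proof.
move=> p0 pk; rewrite ge0_fin_numE ?wsum_ge0//.
apply: le_lt_trans (ltry (Num.max 0 k)); rewrite -wsum_cst ?le_max ?lexx//.
by apply: le_wsum => x; rewrite le_max pk orbT.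
Qed.

Lemma wsum_sum n (phi : 'I_n -> T -> R) : (forall i x, 0 <= phi i x) ->
  wsum (fun x => \sum_(i < n) phi i x) = (\sum_(i < n) wsum (phi i))%E.
Proof.
move=> p0; rewrite /wsum -esum_sum; last first.
  by move=> x i _ _; rewrite lee_fin mulr_ge0.
by apply: eq_esum => x _; rewrite mulr_sumr sumEFin.
Qed.

Lemma expectation_of_ge0 phi : (forall x, 0 <= phi x) ->
  expectation_of pi phi = wsum phi.
Proof.
move=> p0; rewrite /expectation_of (@eq_esum _ _ _ _ (fun x => (pi x * phi x)%:E)).
  rewrite [X in (_ - X)%E](_ : _ = 0%E) ?sube0//; apply: esum1 => x _.
  by rewrite funenegE max_r// -EFinN lee_fin oppr_le0 mulr_ge0.
by move=> x _; rewrite funeposE max_l// lee_fin mulr_ge0.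
Qed.

(** The expectation of [phi] may be [-oo], so the weighted pointwise bound is rearranged as
    [chi + w^+ <= psi + w^-], with nonnegative terms only, before summing. *)
Lemma expectation_of_le phi psi chi : (forall x, 0 <= psi x) -> (forall x, 0 <= chi x) ->
  wsum psi \is a fin_num -> wsum chi \is a fin_num ->
  (forall x, phi x <= psi x - chi x) ->
  (expectation_of pi phi <= wsum psi - wsum chi)%E.
Proof.
move=> psi0 chi0 psifin chifin hle.
have sumD (b : T -> R) c : (forall x, 0 <= b x) -> (forall x, 0 <= c x)%E ->
    \esum_(x in [set: T]) ((pi x * b x)%:E + c x)%E =
    (wsum b + \esum_(x in [set: T]) c x)%E.
  by move=> b0 c0; rewrite esumD// => x _; rewrite lee_fin mulr_ge0.
rewrite /expectation_of; set w := fun x => (pi x * phi x)%:E.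
have H : (wsum chi + \esum_(x in [set: T]) w^\+ x <=
          wsum psi + \esum_(x in [set: T]) w^\- x)%E.
  rewrite -!sumD//; apply: le_esum => x _; rewrite funeposE funenegE /w.
  rewrite -EFinN -!EFin_max -!EFinD lee_fin.
  have := ler_wpM2l (pi_ge0 x) (hle x); rewrite mulrBr.
  rewrite /Num.max; case: ifP; case: ifP; lra.
set a := esum _ _ in H *; set b := esum _ _ in H *.
have b0 : (0 <= b)%E by apply: esum_ge0.
have a0 : (0 <= a)%E by apply: esum_ge0.
(* An infinite negative part makes the expectation [-oo], whatever the positive part. *)
move: b0; case E : b H => [r| |]//= H b0; last first.
  by rewrite addeNy leNye.
move: H; rewrite -(fineK psifin) -(fineK chifin).
case: (a) a0 => [s| |]// a0; rewrite -!EFinD -?EFinN -?EFinD ?lee_fin; lra.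
Qed.

End weighted_sum.

(** * The imbalance process *)

(** Integer-valued, so that its levels can index sums and be compared by [lia]. *)
Definition imbalancez (n : nat) (q : state n) : int :=
  (\sum_(j < n) q.1 j)%N%:Z - (\sum_(i < n) q.2 i)%N%:Z.

Lemma imbalanceE (R : realType) (n : nat) (q : state n) :
  imbalance R q = (imbalancez q)%:~R.
Proof. by rewrite /imbalance /imbalancez rmorphB/= -!pmulrn !natr_sum. Qed.

Lemma sum_kronecker (n : nat) (j : 'I_n) : (\sum_(k < n) (k == j) = 1)%N.
Proof. by rewrite (bigD1 j)//= eqxx big1// => k /negPf ->. Qed.

Section matching.
Variables (n : nat) (y : state n -> 'M[nat]_n).
Hypothesis y_matching : matching_policy y.

Let matched q :
  (\sum_(j < n) \sum_(i < n) y q i j <= \sum_(j < n) q.1 j)%N /\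
  (\sum_(j < n) \sum_(i < n) y q i j <= \sum_(i < n) q.2 i)%N.
Proof.
have [y1 y2] := y_matching q; split; first exact: leq_sum.
by rewrite exchange_big; apply: leq_sum.
Qed.

(** Each match removes one customer and one server, so only the arrival counts; the matching
    constraints make the natural-number subtractions exact. *)
Lemma imbalancez_customer q j :
  imbalancez (after_customer y q j) = imbalancez q + 1.
Proof.
have [y1 y2] := y_matching q.
rewrite /imbalancez /=.
under eq_bigr do rewrite ffunE.
under [X in _ - Posz X]eq_bigr do rewrite ffunE.
rewrite big_split/= !sumnB// sum_kronecker.
rewrite [X in _ - Posz (_ - X)%N]exchange_big/=.
move: (matched q) => [].
set m := (X in (X <= _)%N); set a := (\sum_(j < n) q.1 j)%N; set b := (\sum_(j < n) q.2 j)%N.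
by move=> h1 h2; rewrite PoszD -!subzn//; ring.
Qed.

Lemma imbalancez_server q i :
  imbalancez (after_server y q i) = imbalancez q - 1.
Proof.
have [y1 y2] := y_matching q.
rewrite /imbalancez /=.
under eq_bigr do rewrite ffunE.
under [X in _ - Posz X]eq_bigr do rewrite ffunE.
rewrite big_split/= !sumnB// sum_kronecker.
rewrite [X in _ - Posz (_ - X + _)%N]exchange_big/=.
move: (matched q) => [].
set m := (X in (X <= _)%N); set a := (\sum_(j < n) q.1 j)%N; set b := (\sum_(j < n) q.2 j)%N.
by move=> h1 h2; rewrite PoszD -!subzn//; ring.
Qed.

Variables (R : realType) (lam mu : state n -> 'I_n -> R).
Hypotheses (lam_ge0 : forall q j, 0 <= lam q j) (mu_ge0 : forall q i, 0 <= mu q i).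
Let Q := queue_intensity lam mu y.

Lemma queue_intensity_ge0 q q' : 0 <= Q q q'.
Proof. by rewrite addr_ge0// sumr_ge0. Qed.

(** Every arrival changes the imbalance, so no transition is a loop; sums over [[set~ q]] thus
    extend to all states. *)
Lemma queue_intensity_diag q : Q q q = 0.
Proof.
rewrite /Q /queue_intensity !big_pred0 ?addr0// => k; apply/negP => /eqP /(congr1 (@imbalancez n)).
  by rewrite imbalancez_server; lia.
by rewrite imbalancez_customer; lia.
Qed.

Lemma esum_queue_intensity q (phi : state n -> R) : (forall q', 0 <= phi q') ->
  \esum_(q' in [set: state n]) (Q q q' * phi q')%:E =
  (\sum_(j < n) lam q j * phi (after_customer y q j) +
   \sum_(i < n) mu q i * phi (after_server y q i))%:E.
Proof.
move=> phi0; rewrite (@eq_esum _ _ _ _ (fun q' =>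
   \sum_(j < n) (if q' == after_customer y q j then (lam q j * phi q')%:E else 0) +
   \sum_(i < n) (if q' == after_server y q i then (mu q i * phi q')%:E else 0))%E).
  rewrite esumD; first last.
  - by move=> q' _; apply: sume_ge0 => i _; case: ifP; rewrite // lee_fin mulr_ge0.
  - by move=> q' _; apply: sume_ge0 => i _; case: ifP; rewrite // lee_fin mulr_ge0.
  rewrite !esum_sum; first last.
  - by move=> q' i _ _; case: ifP; rewrite // lee_fin mulr_ge0.
  - by move=> q' i _ _; case: ifP; rewrite // lee_fin mulr_ge0.
  rewrite EFinD -!sumEFin; congr (_ + _)%E; apply: eq_bigr => i _;
    rewrite (@esum_if_eq _ _ _ (fun q' => (_ q i * phi q')%:E))//.
  - by rewrite lee_fin mulr_ge0.
  - by rewrite lee_fin mulr_ge0.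
move=> q' _; rewrite /Q /queue_intensity mulrDl EFinD !big_distrl/=.
by congr (_ + _)%E; rewrite -sumEFin big_mkcond; apply: eq_bigr => i _; case: ifP.
Qed.

Lemma exit_rate_queue q :
  exit_rate Q q = \sum_(j < n) lam q j + \sum_(i < n) mu q i.
Proof.
rewrite /exit_rate esum_mkcond (@eq_esum _ _ _ _ (fun q' => (Q q q' * 1)%:E)).
  rewrite (@esum_queue_intensity q (fun=> 1))//=.
  by congr (_ + _); apply: eq_bigr => i _; rewrite mulr1.
move=> q' _; rewrite mulr1; case: ifPn => //; rewrite notin_setE /= => /contrapT ->.
by rewrite queue_intensity_diag.
Qed.

Variables (C : set (state n)) (pi : state n -> R).
Hypothesis pi_stationary : stationary_distribution Q C pi.
Let pi_ge0 q : 0 <= pi q. Proof. by case: pi_stationary. Qed.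

Let Lam q := \sum_(j < n) lam q j.
Let Mu q := \sum_(i < n) mu q i.
Let Lam_ge0 q : 0 <= Lam q. Proof. exact: sumr_ge0. Qed.
Let Mu_ge0 q : 0 <= Mu q. Proof. exact: sumr_ge0. Qed.

(** Both sides equal the double sum of [pi q * Q q q' * phi (imbalancez q')]: summing over [q']
    first gives the left side, summing over [q] first and using the balance equations gives the
    right side. *)
Lemma stationary_generator (phi : int -> R) : (forall z, 0 <= phi z) ->
  wsum pi (fun q => Lam q * phi (imbalancez q + 1) + Mu q * phi (imbalancez q - 1)) =
  wsum pi (fun q => (Lam q + Mu q) * phi (imbalancez q)).
Proof.
move=> phi0; case: pi_stationary => _ _ _ bal.
pose psi (q : state n) := phi (imbalancez q).
have psi0 q : 0 <= psi q by exact: phi0.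
have Q0 := queue_intensity_ge0.
transitivity (\esum_(q' in [set: state n]) \esum_(q in [set: state n])
    (pi q * (Q q q' * psi q'))%:E).
  rewrite -esum_exchange; last first.
    by move=> q q'; rewrite lee_fin !mulr_ge0//.
  apply: eq_esum => q _;
    rewrite (@eq_esum _ _ _ _ (fun q' => (pi q)%:E * (Q q q' * psi q')%:E)%E)//.
  rewrite ge0_esumZl//; last by move=> q'; rewrite lee_fin mulr_ge0//.
  rewrite esum_queue_intensity// -EFinM; congr (pi q * (_ + _))%:E.
    by rewrite mulr_suml; apply: eq_bigr => j _; rewrite /psi imbalancez_customer.
  by rewrite mulr_suml; apply: eq_bigr => j _; rewrite /psi imbalancez_server.
apply: eq_esum => q' _.
rewrite (@eq_esum _ _ _ _ (fun q => (psi q')%:E * (pi q * Q q q')%:E)%E); last first.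
  by move=> q _; rewrite -EFinM; congr EFin; ring.
rewrite ge0_esumZl//; last by move=> q; rewrite lee_fin mulr_ge0//.
have := bal q'; rewrite esum_mkcond exit_rate_queue -/(Lam q') -/(Mu q') => E.
transitivity ((psi q')%:E * (pi q' * (Lam q' + Mu q'))%:E)%E.
  congr (_ * _)%E; rewrite -E; apply: eq_esum => q _.
  case: ifPn => //; rewrite notin_setE /= => /contrapT ->.
  by rewrite queue_intensity_diag mulr0.
by rewrite -EFinM /psi; congr EFin; ring.
Qed.

Variable K : R.
Hypotheses (Lam_le : forall q, Lam q <= K) (Mu_le : forall q, Mu q <= K).

(* Take the indicator of [imbalancez q > k] in [stationary_generator]. *)
Lemma stationary_cut (k : int) :
  wsum pi (fun q => Lam q * (imbalancez q == k)%R%:R) =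
  wsum pi (fun q => Mu q * (imbalancez q == k + 1)%R%:R).
Proof.
have pi1 : \esum_(x in [set: state n]) (pi x)%:E = 1%E by case: pi_stationary.
have h := stationary_generator (phi := fun z => (k < z)%R%:R) (fun z => ler0n _ _).
(* These terms are common to both sides; bounded rates make their sum finite, so that it can be
   cancelled. *)
pose rest (q : state n) : R := Lam q * (k < imbalancez q)%R%:R + Mu q * (k + 1 < imbalancez q)%R%:R.
have rest0 q : 0 <= rest q by rewrite addr_ge0// mulr_ge0.
have restK q : rest q <= K + K.
  apply: lerD; apply: le_trans (ler_piMr _ _) _; rewrite ?lern1 ?leq_b1 ?Lam_le ?Mu_le//.
have restfin : wsum pi rest \is a fin_num by exact: (wsum_fin_num pi_ge0 pi1 rest0 restK).
set lhs := wsum _ _; set rhs := wsum _ _.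
suff /(congr1 (fun a => a - wsum pi rest)%E) :
    (lhs + wsum pi rest = rhs + wsum pi rest)%E by rewrite !addeK.
rewrite addeC -wsumD//; last by move=> q; rewrite mulr_ge0.
rewrite [RHS]addeC -wsumD//; last by move=> q; rewrite mulr_ge0.
transitivity (wsum pi (fun q => Lam q * (k < imbalancez q + 1)%R%:R +
    Mu q * (k < imbalancez q - 1)%R%:R)).
  apply: eq_wsum => q; rewrite /rest.
  have -> : (k < imbalancez q + 1) = (imbalancez q == k) || (k < imbalancez q) by lia.
  have -> : (k < imbalancez q - 1) = (k + 1 < imbalancez q) by lia.
  by have [->|_] := eqVneq (imbalancez q) k; rewrite ?ltxx/=; ring.
rewrite h; apply: eq_wsum => q; rewrite /rest.
have -> : (k < imbalancez q) = (imbalancez q == k + 1) || (k + 1 < imbalancez q) by lia.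
by have [->|_] := eqVneq (imbalancez q) (k + 1); rewrite ?ltxx/=; ring.
Qed.

(** Sum [stationary_cut] over all [k]; the shift by one only renumbers the levels. *)
Lemma stationary_mean_rates : wsum pi Lam = wsum pi Mu.
Proof.
have decomp (phi : state n -> R) (t : int) : (forall q, 0 <= phi q) ->
    wsum pi phi = \esum_(k in [set: int]) wsum pi (fun q => phi q * (imbalancez q == k + t)%R%:R).
  move=> phi0; rewrite /wsum -esum_exchange; last by move=> *; rewrite lee_fin !mulr_ge0.
  apply: eq_esum => q _.
  rewrite (@eq_esum _ _ _ _ (fun k => if k == imbalancez q - t then (pi q * phi q)%:E else 0%E)).
    by rewrite (@esum_if_eq _ _ _ (fun=> (pi q * phi q)%:E))// lee_fin mulr_ge0.
  move=> k _; rewrite -subr_eq eq_sym [k == _]eq_sym.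
  by case: eqP => _; rewrite ?mulr1 ?mulr0.
rewrite (decomp _ 0)// (decomp Mu 1)//; apply: eq_esum => k _.
by rewrite addr0 stationary_cut.
Qed.

End matching.

(** The equal means of [A] and [B] cancel the term in [s], whatever its sign. *)
Lemma expectation_le_balanced (R : realType) (T : choiceType) (pi : T -> R)
    (phi A B I : T -> R) (V s c K : R) :
  (forall x, 0 <= pi x) -> \esum_(x in [set: T]) (pi x)%:E = 1%E ->
  (forall x, 0 <= A x <= K) -> (forall x, 0 <= B x <= K) -> wsum pi A = wsum pi B ->
  0 <= c -> (forall x, 0 <= I x <= K) ->
  (forall x, phi x <= V + s * (A x - B x) - c * I x) ->
  (expectation_of pi phi <= V%:E - c%:E * wsum pi I)%E.
Proof.
move=> pi0 pi1 AK BK AB c0 IK h.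
have A0 x : 0 <= A x by case/andP: (AK x).
have B0 x : 0 <= B x by case/andP: (BK x).
have I0 x : 0 <= I x by case/andP: (IK x).
have Afin : wsum pi A \is a fin_num.
  by apply: (wsum_fin_num (k := K) pi0 pi1) => // x; case/andP: (AK x).
have Ifin : wsum pi I \is a fin_num.
  by apply: (wsum_fin_num (k := K) pi0 pi1) => // x; case/andP: (IK x).
(* Splitting [V] and [s] into positive and negative parts makes [psi] and [chi] nonnegative, as
   [expectation_of_le] requires. *)
pose posp (r : R) := Num.max 0 r.
have posp0 r : 0 <= posp r by rewrite le_max lexx.
have pospB r : posp r - posp (- r) = r by rewrite /posp /Num.max; case: ifP; case: ifP; lra.
pose comb (k1 s1 s2 : R) (x : T) := k1 + (s1 * A x + s2 * B x).
have comb0 k1 s1 s2 x : 0 <= k1 -> 0 <= s1 -> 0 <= s2 -> 0 <= comb k1 s1 s2 x.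
  by move=> *; rewrite !addr_ge0// mulr_ge0.
have combE k1 s1 s2 : 0 <= k1 -> 0 <= s1 -> 0 <= s2 ->
    wsum pi (comb k1 s1 s2) = (k1 + (s1 + s2) * fine (wsum pi A))%:E.
  move=> k10 s10 s20; rewrite wsumD//; last by move=> x; rewrite addr_ge0// mulr_ge0.
  rewrite wsum_cst// wsumD//; try by move=> x; rewrite mulr_ge0.
  rewrite !wsumZ// -AB -(fineK Afin) -!EFinM -!EFinD; congr EFin => /=; ring.
pose psi := comb (posp V) (posp s) (posp (- s)).
pose chi x := comb (posp (- V)) (posp (- s)) (posp s) x + c * I x.
have chiE : wsum pi chi = (posp (- V) + (posp s + posp (- s)) * fine (wsum pi A)
    + c * fine (wsum pi I))%:E.
  rewrite wsumD//; [|by move=> x; exact: comb0|by move=> x; rewrite mulr_ge0].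
  by rewrite combE// wsumZ// -{1}(fineK Ifin) -EFinM -EFinD; congr EFin; ring.
have psiE := combE _ _ _ (posp0 V) (posp0 s) (posp0 (- s)).
apply: (le_trans (expectation_of_le pi0 (psi := psi) (chi := chi) _ _ _ _ _)).
- by move=> x; exact: comb0.
- by move=> x; rewrite addr_ge0 ?comb0// mulr_ge0.
- by rewrite /psi psiE.
- by rewrite chiE.
- move=> x; apply: le_trans (h x) _; rewrite /psi /chi /comb.
  rewrite -{1}(pospB V) -{1}(pospB s) le_eqVlt; apply/orP; left; apply/eqP; ring.
rewrite psiE chiE -(fineK Ifin) -EFinM -!EFinN -!EFinD lee_fin.
by rewrite -{3}(pospB V) le_eqVlt; apply/orP; left; apply/eqP => /=; ring.
Qed.

(** Here [k] stands for the number of types and [A], [B] for the rates of the [eta]-th system, with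
    deviations [U], [W]. Multiplying the per-type bound by [k * eta] leaves one factor [1 / eta] on
    the squared deviations. *)
Lemma scale_bound (R : realFieldType) (k eta A B FA GB V s a U W : R) :
  0 <= k -> 0 < eta ->
  A / eta * FA - B / eta * GB <= V + s * (A / eta - B / eta)
    - a * ((U / eta) ^+ 2 + (W / eta) ^+ 2) ->
  k * (A * FA) - k * (B * GB) <= eta * (k * V) + s * (k * A - k * B)
    - k * a / eta * (U ^+ 2 + W ^+ 2).
Proof.
move=> k0 eta0 h; have := ler_wpM2l (mulr_ge0 k0 (ltW eta0)) h.
have en0 : eta != 0 by rewrite gt_eqF.
rewrite (_ : k * eta * (_ * FA - _ * GB) = k * (A * FA) - k * (B * GB)); last by field.
move/le_trans; apply; rewrite le_eqVlt; apply/orP; left; apply/eqP.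
by field.
Qed.

(** * Symmetric policies *)

Section symmetric_queue.
Variables (R : realType) (n : nat) (y : state n -> 'M[nat]_n).
Variables (L t : R) (u v : int -> R).
Variables (C : set (state n)) (pi : state n -> R).
Hypotheses (n_gt0 : (0 < n)%N) (y_matching : matching_policy y).
Hypotheses (L_gt0 : 0 < L) (t_gt0 : 0 < t) (t_le_L : t <= L).
Hypotheses (u_le : forall k, `|u k| <= t) (v_le : forall k, `|v k| <= t).
Let lam (q : state n) (_ : 'I_n) : R := L + u (imbalancez q).
Let mu (q : state n) (_ : 'I_n) : R := L + v (imbalancez q).
Hypothesis pi_stationary : stationary_distribution (queue_intensity lam mu y) C pi.

Let Lu_ge0 k : 0 <= L + u k.
Proof.
move: (u_le k); rewrite ler_norml => /andP[h _].
by rewrite -lerBlDl sub0r (le_trans _ h)// lerN2.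
Qed.
Let Lv_ge0 k : 0 <= L + v k.
Proof.
move: (v_le k); rewrite ler_norml => /andP[h _].
by rewrite -lerBlDl sub0r (le_trans _ h)// lerN2.
Qed.
Let lam_ge0 q j : 0 <= lam q j. Proof. exact: Lu_ge0. Qed.
Let mu_ge0 q i : 0 <= mu q i. Proof. exact: Lv_ge0. Qed.

Let pi_ge0 q : 0 <= pi q. Proof. by case: pi_stationary. Qed.
Let pi_sum1 : \esum_(x in [set: state n]) (pi x)%:E = 1%E.
Proof. by case: pi_stationary. Qed.

Let Lam (q : state n) := \sum_(j < n) lam q j.
Let Mu (q : state n) := \sum_(i < n) mu q i.
Let LamE q : Lam q = n%:R * (L + u (imbalancez q)).
Proof. by rewrite /Lam sumr_const card_ord mulr_natl. Qed.
Let MuE q : Mu q = n%:R * (L + v (imbalancez q)).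
Proof. by rewrite /Mu sumr_const card_ord mulr_natl. Qed.
Let K := n%:R * (L + t).
Let Lam_le q : Lam q <= K.
Proof. by rewrite LamE ler_wpM2l// lerD2l; exact: le_trans (ler_norm _) (u_le _). Qed.
Let Mu_le q : Mu q <= K.
Proof. by rewrite MuE ler_wpM2l// lerD2l; exact: le_trans (ler_norm _) (v_le _). Qed.

Let r (k : int) := fine (wsum pi (fun q => (imbalancez q == k)%R%:R)).

Let rE k : wsum pi (fun q => (imbalancez q == k)%R%:R) = (r k)%:E.
Proof.
rewrite fineK//; apply: (wsum_fin_num (k := 1) pi_ge0 pi_sum1) => q //.
by rewrite lern1 leq_b1.
Qed.

Let r_ge0 k : 0 <= r k. Proof. by rewrite -lee_fin -rE wsum_ge0. Qed.

Let flux (w : int -> R) k : (forall k, 0 <= L + w k) ->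
  wsum pi (fun q => (\sum_(j < n) (L + w (imbalancez q))) * (imbalancez q == k)%R%:R) =
  (n%:R * ((L + w k) * r k))%:E.
Proof.
move=> w0; rewrite mulrA [RHS]EFinM -rE -wsumZ ?mulr_ge0//.
apply: eq_wsum => q; rewrite sumr_const card_ord -[_ *+ n]mulr_natl.
by have [->|_] := eqVneq (imbalancez q) k; rewrite //= !mulr0.
Qed.

Let r_step k : L * `|r (k + 1) - r k| <= t * (r k + r (k + 1)).
Proof.
have uv : (L + u k) * r k = (L + v (k + 1)) * r (k + 1).
  have := stationary_cut y_matching lam_ge0 mu_ge0 pi_stationary Lam_le Mu_le k.
  rewrite (flux k Lu_ge0) (flux (k + 1) Lv_ge0) => -[]; apply: mulfI.
  by rewrite pnatr_eq0 -lt0n.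
rewrite -[X in X * _](gtr0_norm L_gt0) -normrM.
rewrite (_ : L * _ = u k * r k - v (k + 1) * r (k + 1)); last first.
  by rewrite mulrBr; move: uv; rewrite !mulrDl; lra.
apply: le_trans (ler_normB _ _) _; rewrite !normrM !(ger0_norm (r_ge0 _)) mulrDr.
by apply: lerD; exact: ler_wpM2r.
Qed.

Let window (k : int) N :
  wsum pi (fun q => (k <= imbalancez q < k + N%:Z)%R%:R) = (\sum_(i < N) r (k + i%:Z))%:E.
Proof.
rewrite -sumEFin; under [RHS]eq_bigr do rewrite -rE.
rewrite -wsum_sum//; apply: eq_wsum => q.
elim: N => [|N IHN]; first by rewrite big_ord0 addr0; case: ltgtP.
rewrite big_ord_recr/= -IHN -natrD; congr _%:R.
set z := imbalancez q; have [->|zk] := eqVneq z (k + N%:Z).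
  by rewrite ltxx andbF add0n; lia.
by rewrite addn0; congr nat_of_bool; lia.
Qed.

Let window_le1 k N : \sum_(i < N) r (k + i%:Z) <= 1.
Proof.
rewrite -lee_fin -window -(wsum_cst pi_ge0 pi_sum1 ler01).
by apply: le_wsum => // q; rewrite lern1 leq_b1.
Qed.

Let e := 2 * t / L.

(** Telescoping [r_step] produces two windows of the law [r], each of mass at most 1; the error
    [2 * t / L] is therefore independent of [N]. *)
Let r_drift k N : r k <= r (k + N%:Z) + e.
Proof.
suff : r k <= r (k + N%:Z) + t / L * (\sum_(i < N) r (k + i%:Z) + \sum_(i < N) r (k + 1 + i%:Z)).
  move/le_trans; apply; rewrite lerD2l (_ : e = t / L * (1 + 1)); last first.
    by rewrite /e; field; rewrite gt_eqF.
  by rewrite ler_wpM2l ?lerD ?window_le1// divr_ge0// ltW.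
elim: N => [|N IHN]; first by rewrite !big_ord0 !addr0 mulr0 addr0.
rewrite !big_ord_recr/=.
have step j : r j - r (j + 1) <= t / L * (r j + r (j + 1)).
  rewrite mulrAC ler_pdivlMr// mulrC; apply: le_trans (r_step _).
  by rewrite ler_pM2l// distrC ler_norm.
have := step (k + N%:Z); rewrite (_ : k + N%:Z + 1 = k + N.+1%:Z); last by lia.
rewrite (_ : k + 1 + N%:Z = k + N.+1%:Z); last by lia.
by rewrite !mulrDr in IHN *; lra.
Qed.

(** If [r k > e], then by [r_drift] every later [r (k + i)] is at least the positive constant
    [r k - e], which is impossible for a total mass of 1. *)
Let point_mass k : r k <= e.
Proof.
rewrite leNgt; apply/negP; rewrite -subr_gt0 => d0.
have bound N : N%:R * (r k - e) <= 1.
  apply: le_trans (window_le1 k N); rewrite mulr_natl -[X in _ *+ X]card_ord -sumr_const.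
  by apply: ler_sum => i _; have := r_drift k i; lra.
have := bound (Num.truncn (r k - e)^-1).+1.
by rewrite leNgt -ltr_pdivrMr// mul1r truncnS_gt.
Qed.

Lemma symmetric_anticoncentration x : 0 <= x ->
  ((1 - (2 * x + 1) * e)%:E <= wsum pi (fun q => (x < `|(imbalancez q)%:~R|)%R%:R))%E.
Proof.
move=> x0; set far := wsum _ _.
(* The [M] integers from [- N] to [N] are those of absolute value at most [x]. *)
pose N := Num.truncn x; pose M := (2 * N + 1)%N.
have near_le : (wsum pi (fun q => (- N%:Z <= imbalancez q < - N%:Z + M%:Z)%R%:R) <=
    ((2 * x + 1) * e)%:E)%E.
  rewrite window lee_fin; apply: (@le_trans _ _ (M%:R * e)).
    rewrite mulr_natl -[X in _ *+ X]card_ord -sumr_const.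
    by apply: ler_sum => i _; exact: point_mass.
  have e0 : 0 <= e by rewrite divr_ge0 ?mulr_ge0// ltW.
  rewrite ler_wpM2r// /M natrD natrM lerD2r ler_wpM2l//.
  by rewrite truncn_le.
rewrite EFinB leeBlDr// -(wsum_cst pi_ge0 pi_sum1 ler01).
apply: (@le_trans _ _ (far + wsum pi
    (fun q => (- N%:Z <= imbalancez q < - N%:Z + M%:Z)%R%:R))%E); last first.
  by rewrite leeD2l.
rewrite -wsumD//; apply: le_wsum => // q.
rewrite -natrD ler1n lt0n addn_eq0 negb_and !eqb0 !negbK.
have [//|zx] := ltP x; rewrite /=.
have : `|imbalancez q|%N%:R <= x by rewrite natr_absz intr_norm.
by rewrite -truncn_ge_nat// -/N /M; lia.
Qed.

Hypothesis e_le : e <= 4^-1.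

Let e_gt0 : 0 < e. Proof. by rewrite divr_gt0// mulr_gt0. Qed.

(** The total queue length is at least [|z|], whose mean is bounded below by Markov's inequality. *)
Lemma symmetric_queue_cost_ge :
  ((L / (32 * t))%:E <= \sum_(j < n) expectation_of pi (fun q => (q.1 j)%:R) +
                        \sum_(i < n) expectation_of pi (fun q => (q.2 i)%:R))%E.
Proof.
under eq_bigr do rewrite expectation_of_ge0//.
under [X in (_ + X)%E]eq_bigr do rewrite expectation_of_ge0//.
rewrite -!wsum_sum//.
rewrite -wsumD//; [|by move=> q; rewrite sumr_ge0..].
(* At this threshold [(2 * x + 1) * e = 1/4 + e <= 1/2], so the mean is at least
   [x / 2 = L / (32 * t)]. *)
pose x := (8 * e)^-1.
have x0 : 0 < x by rewrite invr_gt0 mulr_gt0.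
apply: (@le_trans _ _ (wsum pi (fun q => x * (x < `|(imbalancez q)%:~R|)%R%:R))); last first.
  apply: le_wsum => // q; apply: (@le_trans _ _ `|(imbalancez q)%:~R|).
    by case: ltP => [/ltW|_]; rewrite ?mulr1 ?mulr0.
  rewrite -imbalanceE; apply: le_trans (ler_normB _ _) _.
  by rewrite !ger0_norm// sumr_ge0.
rewrite (wsumZ _ (ltW x0))//; apply: (@le_trans _ _ (x%:E * (1 - (2 * x + 1) * e)%:E)%E).
  rewrite -EFinM lee_fin.
  have xe : x * e = 8^-1 by rewrite /x; field; rewrite gt_eqF.
  rewrite (_ : L / (32 * t) = x / 2); last first.
    by rewrite /x /e; field; rewrite !gt_eqF.
  rewrite ler_pM2l// mulrDl mul1r -mulrA xe; move: e_le; lra.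
by rewrite lee_pmul2l// symmetric_anticoncentration// ltW.
Qed.

(** When the pointwise bound is averaged, the [s] term vanishes by [stationary_mean_rates], and the
    event [x1 < |z|] has probability at least 1/2, whence the 2 in the denominator. The waiting cost
    adds [L / (32 * t)]. *)
Lemma symmetric_profit_loss_ge (DF DG : set R) (F G : R -> R) (eta : nat)
    (l V s a theta x1 : R) :
  (0 < eta)%N -> L = eta%:R * l -> 0 <= a -> 0 <= x1 -> 0 <= theta ->
  (forall q : state n, let x := (L + u (imbalancez q)) / eta%:R in
    let w := (L + v (imbalancez q)) / eta%:R in
    x * F x - w * G w <= V + s * (x - w) - a * ((x - l) ^+ 2 + (w - l) ^+ 2)) ->
  fluid_value n DF DG F G = n%:R * V ->
  (forall k : int, x1 < `|k%:~R| -> theta <= `|u k| \/ theta <= `|v k|) ->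
  (2 * x1 + 1) * e <= 2^-1 ->
  ((n%:R * a * theta ^+ 2 / (2 * eta%:R) + L / (32 * t))%:E <=
   profit_loss DF DG F G eta lam mu pi)%E.
Proof.
move=> eta0 Ll a0 x10 theta0 hPC fluidV far hx1.
have etaR : 0 < eta%:R :> R by rewrite ltr0n.
have eta_n0 : eta%:R != 0 :> R by rewrite gt_eqF.
have K0 : 0 <= K by rewrite mulr_ge0// addr_ge0 ?ltW.
pose I (q : state n) : R := (x1 < `|(imbalancez q)%:~R|)%R%:R.
pose c := n%:R * a * theta ^+ 2 / eta%:R.
have c0 : 0 <= c by rewrite divr_ge0 ?mulr_ge0 ?sqr_ge0.
have pointwise q : profit_rate (scaled_curve eta F) (scaled_curve eta G) (lam q) (mu q)
    <= eta%:R * fluid_value n DF DG F G + s * (Lam q - Mu q) - c * I q.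
  rewrite LamE MuE fluidV /profit_rate /scaled_curve /lam /mu !sumr_const !card_ord.
  have := hPC q => /=; have := far (imbalancez q).
  rewrite /I; set U := u _; set W := v _; set z := _%:~R => fz h.
  have E1 : (L + U) / eta%:R - l = U / eta%:R by rewrite Ll; field.
  have E2 : (L + W) / eta%:R - l = W / eta%:R by rewrite Ll; field.
  rewrite E1 E2 in h.
  rewrite -!(mulr_natl (_ * _)); apply: le_trans (scale_bound (ler0n _ n) etaR h) _.
  rewrite lerD2l lerN2 /c.
  case: (ltP x1) fz => [_ /(_ isT) fz|_ _]; last first.
    by rewrite mulr0 mulr_ge0 ?addr_ge0 ?sqr_ge0// divr_ge0// mulr_ge0.
  rewrite mulr1 mulrAC ler_wpM2l ?divr_ge0 ?mulr_ge0//.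
  have sq w : theta <= `|w| -> theta ^+ 2 <= w ^+ 2.
    by move=> tw; rewrite -[w ^+ 2]real_normK ?num_real// lerXn2r ?nnegrE.
  by case: fz => /sq; have := sqr_ge0 U; have := sqr_ge0 W; lra.
(* The single constant [K + 1] bounds both the rates and the indicator [I]. *)
have K1 : K <= K + 1 by lra.
have meanE := stationary_mean_rates y_matching lam_ge0 mu_ge0 pi_stationary Lam_le Mu_le.
have := @expectation_le_balanced _ _ pi _ Lam Mu I _ s c (K + 1)
  pi_ge0 pi_sum1 _ _ meanE c0 _ pointwise.
move=> /(_ _ _ _)/wrap[].
- by move=> q; rewrite sumr_ge0//= (le_trans (Lam_le q)).
- by move=> q; rewrite sumr_ge0//= (le_trans (Mu_le q)).
- by move=> q; rewrite ler0n /I; case: ltP => _; rewrite /=; lra.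
move=> profit_le.
have farprob : (2^-1%:E <= wsum pi I)%E.
  apply: le_trans (symmetric_anticoncentration x10); rewrite lee_fin; lra.
have {}profit_le : (expectation_of pi (fun q => profit_rate (scaled_curve eta F)
     (scaled_curve eta G) (lam q) (mu q)) <=
     (eta%:R * fluid_value n DF DG F G - c / 2)%:E)%E.
  apply: le_trans profit_le _; rewrite EFinB leeB// EFinM.
  by rewrite lee_wpmul2l.
have := symmetric_queue_cost_ge.
rewrite /profit_loss; set qA := (\sum_(j < n) _)%E; set qB := (\sum_(i < n) _)%E.
have qA0 : (0 <= qA)%E by apply: sume_ge0 => j _; rewrite expectation_of_ge0// wsum_ge0.
have qB0 : (0 <= qB)%E by apply: sume_ge0 => j _; rewrite expectation_of_ge0// wsum_ge0.
move: profit_le; set pr := expectation_of _ _ => profit_le.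
rewrite (_ : n%:R * a * theta ^+ 2 / (2 * eta%:R) = c / 2); last by rewrite /c; field.
set S := eta%:R * _ in profit_le *.
(* An infinite mean queue, or a revenue of [-oo], makes the loss [+oo]; only the finite case needs
   arithmetic. *)
case: (qA) qA0 => [qa| |]// _; case: (qB) qB0 => [qb| |]// _;
  case: (pr) profit_le => [p| |]//=; rewrite ?leey// -?EFinN -?EFinD ?lee_fin //=; lra.
Qed.

End symmetric_queue.

(** * Asymptotics *)

Lemma limn_einf_ge (R : realType) (u : (\bar R)^nat) (x : \bar R) :
  (\forall n \near \oo, (x <= u n)%E) -> (x <= limn_einf u)%E.
Proof.
move=> [N _ Nx]; rewrite limn_einf_lim; apply: lime_ge; first exact: is_cvg_einfs.
exists N => // m /= Nm; apply: le_ereal_inf_tmp => _ [k /= mk <-].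
by apply: Nx => /=; exact: leq_trans mk.
Qed.

Lemma powR_sublinear (R : realType) (r eps : R) : r < 1 -> 0 < eps ->
  \forall k \near \oo, (k%:R : R) `^ r <= eps * k%:R.
Proof.
move=> r1 eps0; have r10 : 0 < 1 - r by lra.
near=> k.
have k0 : 0 < k%:R :> R by near: k; exact: nbhs_infty_gtr.
(* Beyond this threshold [k] to the power [1 - r] is at least [1 / eps]. *)
have kM : (eps^-1) `^ (1 - r)^-1 < k%:R by near: k; exact: nbhs_infty_gtr.
have eV0 : 0 <= eps^-1 by rewrite invr_ge0 ltW.
have : eps^-1 <= k%:R `^ (1 - r).
  rewrite -[leLHS]powRr1// -[X in _ `^ X](mulVf (lt0r_neq0 r10)) powRrM.
  by apply: (ge0_ler_powR (ltW r10)); rewrite ?nnegrE ?powR_ge0 ?ler0n// ltW.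
move=> h; have kE : k%:R = k%:R `^ (1 - r) * k%:R `^ r :> R.
  by rewrite -powRD ?subrK ?powRr1 ?(ltW k0)//; apply/implyP => _; rewrite gt_eqF.
rewrite [in leRHS]kE mulrA ler_peMl ?powR_ge0//.
by rewrite -ler_pdivrMl// mulr1.
Unshelve. all: by end_near.
Qed.

(** With [X = A * t ^+ 2] and [Y = B / t], the product [X * Y ^+ 2] is free of [t], and it is
    dominated by [(X + Y) ^+ 3]. *)
Lemma cube_amgm (R : realFieldType) (A B t w : R) :
  0 <= A -> 0 <= B -> 0 < t -> 0 <= w -> w ^+ 3 = A * B ^+ 2 ->
  w <= A * t ^+ 2 + B / t.
Proof.
move=> A0 B0 t0 w0 wE.
have X0 : 0 <= A * t ^+ 2 by rewrite mulr_ge0 ?sqr_ge0.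
have Y0 : 0 <= B / t by rewrite divr_ge0// ltW.
have XY : w ^+ 3 = (A * t ^+ 2) * (B / t) ^+ 2 by rewrite wE; field; rewrite gt_eqF.
have sum0 := addr_ge0 X0 Y0.
rewrite -(@ler_pXn2r _ 3)// ?nnegrE// {sum0}XY.
move: X0 Y0; set X := A * t ^+ 2; set Y := B / t => X0 Y0.
rewrite (_ : (X + Y) ^+ 3 = X * Y ^+ 2 +
  (X ^+ 3 + 3 * (X ^+ 2 * Y) + 2 * (X * Y ^+ 2) + Y ^+ 3)); last by ring.
have := mulr_ge0 (exprn_ge0 2 X0) Y0; have := mulr_ge0 X0 (exprn_ge0 2 Y0).
by have := exprn_ge0 3 X0; have := exprn_ge0 3 Y0; lra.
Qed.

Lemma powR_cbrtK (R : realType) (x : R) : 0 <= x -> (x `^ 3^-1) ^+ 3 = x.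
Proof. by move=> x0; rewrite -powR_mulrn ?powR_ge0// -powRrM mulVf ?pnatr_eq0// powRr1. Qed.

(** * Reduction of the fluid problem to a single type *)

Section fluid.
Variables (R : realType) (DF DG : set R) (F G : R -> R) (n : nat) (l : R).
Hypotheses (hDF : rate_range DF) (n_gt0 : (0 < n)%N).
Hypothesis opt : fluid_optimal DF DG F G (fun _ : 'I_n => l) (fun _ : 'I_n => l).

Let profit_cst x : profit_rate F G (fun _ : 'I_n => x) (fun _ : 'I_n => x) =
  n%:R * (x * F x - x * G x).
Proof. by rewrite /profit_rate !sumr_const card_ord mulrBr !mulr_natl. Qed.

Lemma fluid_optimal_maximizer : [/\ DF l, DG l &
  forall x, DF x -> DG x -> x * F x - x * G x <= l * F l - l * G l].
Proof.
case: opt => -[hl hm _] optl.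
have i0 := Ordinal n_gt0; split; [exact: hl i0|exact: hm i0|move=> x DFx DGx].
have := optl (fun=> x) (fun=> x); rewrite !profit_cst ler_pM2l ?ltr0n//; apply.
(* Constant rates [x] are realized by the diagonal flow matching type [i] with type [i] only. *)
split => //; exists x%:M; case: hDF => _ D0 _.
have row (i : 'I_n) : \sum_(j < n) (x%:M : 'M[R]_n) i j = x.
  rewrite (bigD1 i)//= big1 ?addr0 ?mxE ?eqxx// => j ji.
  by rewrite mxE eq_sym (negPf ji).
split => [i j|j|i]; rewrite ?row//.
  by rewrite mxE mulrn_wge0// D0.
by rewrite -[LHS](row j); apply: eq_bigr => i _; rewrite !mxE eq_sym.
Qed.

Lemma fluid_valueE : fluid_value n DF DG F G = n%:R * (l * F l - l * G l).
Proof.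
rewrite -profit_cst /fluid_value; set S := [set _ | _]; case: opt => feas optl.
set M := profit_rate F G _ _ in optl *.
have SM : S M by exists (fun=> l), (fun=> l).
have ubS : ubound S M.
  by move=> _ [a [b [ab ->]]]; exact: optl.
apply/eqP; rewrite eq_le ge_sup//=; last by exists M.
by apply: ub_le_sup => //; exists M.
Qed.

End fluid.

(** * Choice of the constants and the cube-root lower bound *)

Theorem theorem6 (R : realType) (DF DG : set R) (F G : R -> R) (delta : R)
    (hDF : rate_range DF) (hDG : rate_range DG)
    (hF : inverse_demand_curve DF F) (hG : inverse_supply_curve DG G)
    (hdelta : 0 < delta) :
  exists2 c : R, 0 < c &
  forall (n : nat) (lambda_s mu_s alpha beta Gamma kappa : R) (f g : R -> R),
    (0 < n)%N ->
    fluid_optimal DF DG F G (fun _ : 'I_n => lambda_s) (fun _ : 'I_n => mu_s) ->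
    0 < lambda_s -> lambda_s = mu_s ->
    0 <= alpha <= 1 -> 0 < beta < 1 ->
    (forall x, `|f x| <= Gamma /\ `|g x| <= Gamma) ->
    0 < alpha + beta < 1 ->
    0 < kappa ->
    (forall x, kappa < x -> f x < - (delta * Gamma) \/ delta * Gamma < g x) ->
    (forall x, x < - kappa -> delta * Gamma < f x \/ g x < - (delta * Gamma)) ->
  forall (y : nat -> state n -> 'M[nat]_n) (C : nat -> set (state n))
    (pi : nat -> state n -> R),
    let lam eta := @symmetric_rate R n eta alpha beta lambda_s f in
    let mu eta := @symmetric_rate R n eta alpha beta mu_s g in
    let Q eta := queue_intensity (lam eta) (mu eta) (y eta) in
    (forall eta, matching_policy (y eta)) ->
    (\forall eta \near \oo,
       [/\ feasible_rates eta DF (lam eta), feasible_rates eta DG (mu eta),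
           stable_class (Q eta) (C eta)
         & stationary_distribution (Q eta) (C eta) (pi eta)]) ->
    ((c * n%:R `^ (3^-1))%:E <=
     limn_einf (fun eta : nat =>
       profit_loss DF DG F G eta (lam eta) (mu eta) (pi eta)
       * ((eta%:R `^ (3^-1))^-1)%:E))%E.
Proof.
have [DFitv _ _] := hDF; have [DGitv _ _] := hDG.
have [_ _ _ [p2 [p [Pp pp2]] p2_lt0]] := hF.
have [_ _ _ [c2 [c [Cc cc2]] c2_gt0]] := hG.
pose maximizer x0 := [/\ DF x0, DG x0 &
  forall x, DF x -> DG x -> x * F x - x * G x <= x0 * F x0 - x0 * G x0].
(* The constant must be fixed before [n], so [l] comes from the per-type problem, which does not
   involve [n]; [maximizer_unique] later identifies it with the given rate. Without a positive
   maximizer no instance satisfies the hypotheses, and any constant will do. *)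
have [[l [l_gt0 lmax]]|nomax] := pselect (exists l, 0 < l /\ maximizer l); last first.
  exists 1 => // n l m alpha beta Gamma kappa f g n0 opt l0 lm.
  case: nomax; exists l; split=> //; apply: (fluid_optimal_maximizer hDF n0).
  by rewrite {2}lm.
have [a a_gt0 [d d_gt0 [s hs]]] := maximizer_lagrangian_bound DFitv DGitv Pp Cc
  pp2 cc2 p2_lt0 c2_gt0 lmax.
(* Chosen so that [A * B ^+ 2 = c0 * n * eta] for [A = n * a * delta ^+ 2 / (2 * eta)] and
   [B = eta * l / 32], the coefficients of [t ^+ 2] and [1 / t] in the loss. *)
pose c0 := a * delta ^+ 2 * l ^+ 2 / (2 * 32 ^+ 2).
have c0_gt0 : 0 < c0.
  by apply: divr_gt0; rewrite ?mulr_gt0 ?exprn_gt0.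
exists (c0 `^ 3^-1); first by rewrite powR_gt0.
move=> n ls ms alpha beta Gamma kappa f g n0 opt ls0 lsms.
rewrite -{}lsms in opt *.
have {ls0}lsE : ls = l.
  apply: (maximizer_unique DFitv DGitv Pp Cc pp2 cc2 p2_lt0 c2_gt0) lmax.
  exact: (fluid_optimal_maximizer hDF n0).
rewrite {ls}lsE in opt *.
move=> /andP[alpha0 alpha1] /andP[beta0 beta1] fgG /andP[ab0 ab1] kappa0 far_pos far_neg.
move=> y C pi lam mu Q y_matching near_stationary.
(* If [Gamma] were 0, then [f] and [g] would vanish, against the strict inequalities beyond
   [kappa]. *)
have Gamma_gt0 : 0 < Gamma.
  have [f1 g1] := fgG (kappa + 1).
  rewrite lt_neqAle (le_trans _ f1)// andbT; apply/negP => /eqP G0.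
  have kk : kappa < kappa + 1 by rewrite ltrDl.
  move: f1 g1 (far_pos _ kk); rewrite -G0 mulr0 oppr0 !normr_le0 => /eqP-> /eqP->.
  by rewrite ltxx; case.
apply: limn_einf_ge.
(* The first bound keeps the scaled rates within [d] of [l], where the Lagrangian bound holds; the
   second gives [16 * t <= L]. Below, [eps'] gives [16 * x1 * t <= L], which is where
   [alpha + beta < 1] enters. *)
pose eps := Num.min (d / (2 * Gamma)) (l / (16 * Gamma)).
have eps_gt0 : 0 < eps by rewrite lt_min !divr_gt0// mulr_gt0.
pose eps' := l / (16 * kappa * Gamma).
have eps'_gt0 : 0 < eps' by rewrite divr_gt0// !mulr_gt0.
near=> eta.
have [DFlam DGmu _ statpi] : [/\ feasible_rates eta DF (lam eta), feasible_rates eta DG (mu eta),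
    stable_class (Q eta) (C eta) & stationary_distribution (Q eta) (C eta) (pi eta)].
  by near: eta.
have eta_gt0 : (0 < eta)%N by near: eta; exists 1%N.
have etaR : 0 < eta%:R :> R by rewrite ltr0n.
have eta_beta : eta%:R `^ beta <= eps * eta%:R.
  by near: eta; exact: powR_sublinear.
have eta_alphabeta : eta%:R `^ (alpha + beta) <= eps' * eta%:R.
  by near: eta; exact: powR_sublinear.
have etab_gt0 : 0 < eta%:R `^ beta :> R by rewrite powR_gt0.
have etaa_gt0 : 0 < eta%:R `^ alpha :> R by rewrite powR_gt0.
rewrite powRD in eta_alphabeta; last by apply/implyP => _; rewrite gt_eqF.
pose t := Gamma * eta%:R `^ beta.
have t_gt0 : 0 < t by rewrite mulr_gt0.
pose L := eta%:R * l.
have L_gt0 : 0 < L by rewrite mulr_gt0.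
have td : 2 * t <= d * eta%:R.
  have : eta%:R `^ beta <= d / (2 * Gamma) * eta%:R.
    by apply: (le_trans eta_beta); rewrite ler_pM2r// ge_min lexx.
  rewrite mulrAC ler_pdivlMr ?mulr_gt0// => h.
  by rewrite /t mulrA mulrC.
have tL : 16 * t <= L.
  have : eta%:R `^ beta <= l / (16 * Gamma) * eta%:R.
    by apply: (le_trans eta_beta); rewrite ler_pM2r// ge_min lexx orbT.
  rewrite mulrAC ler_pdivlMr ?mulr_gt0// => h.
  by rewrite /t /L mulrA mulrC [eta%:R * l]mulrC.
have tkL : 16 * (kappa * eta%:R `^ alpha * t) <= L.
  move: eta_alphabeta; rewrite mulrAC ler_pdivlMr ?mulr_gt0// => h.
  rewrite /L [eta%:R * l]mulrC; apply: le_trans h; rewrite le_eqVlt; apply/orP; left.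
  by apply/eqP; rewrite /t; ring.
pose u (k : int) := f (k%:~R / eta%:R `^ alpha) * eta%:R `^ beta.
pose v (k : int) := g (k%:~R / eta%:R `^ alpha) * eta%:R `^ beta.
have u_le k : `|u k| <= t.
  rewrite normrM (gtr0_norm etab_gt0) ler_pM2r//.
  by case: (fgG (k%:~R / eta%:R `^ alpha)).
have v_le k : `|v k| <= t.
  rewrite normrM (gtr0_norm etab_gt0) ler_pM2r//.
  by case: (fgG (k%:~R / eta%:R `^ alpha)).
have lamE : lam eta = (fun q _ => L + u (imbalancez q)).
  by apply/funext => q; apply/funext => j; rewrite /lam /symmetric_rate imbalanceE.
have muE : mu eta = (fun q _ => L + v (imbalancez q)).
  by apply/funext => q; apply/funext => j; rewrite /mu /symmetric_rate imbalanceE.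
have statpi' := statpi; rewrite /Q lamE muE in statpi'.
have tL1 : t <= L by lra.
have e_le : 2 * t / L <= 4^-1 by rewrite ler_pdivrMr//; lra.
pose x1 := kappa * eta%:R `^ alpha.
have x1_ge0 : 0 <= x1 by rewrite mulr_ge0// ltW.
pose theta := delta * t.
have theta_ge0 : 0 <= theta by rewrite mulr_ge0// ltW.
(* The two terms are at most 1/4 and 1/8. *)
have x1_le : (2 * x1 + 1) * (2 * t / L) <= 2^-1.
  by rewrite mulrA ler_pdivrMr//; rewrite -/x1 in tkL; lra.
have scaled w : `|w| <= t -> `|(L + w) / eta%:R - l| < d.
  move=> wt; rewrite (_ : _ - l = w / eta%:R); last by rewrite /L; field; rewrite gt_eqF.
  by rewrite normrM normfV (gtr0_norm etaR) ltr_pdivrMr//; lra.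
have local (q : state n) : let x := (L + u (imbalancez q)) / eta%:R in
    let w := (L + v (imbalancez q)) / eta%:R in
    x * F x - w * G w <= l * F l - l * G l + s * (x - w)
      - a * ((x - l) ^+ 2 + (w - l) ^+ 2).
  move=> x w; apply: hs; rewrite ?scaled//.
    by have := DFlam q (Ordinal n0); rewrite lamE.
  by have := DGmu q (Ordinal n0); rewrite muE.
have far (k : int) : x1 < `|k%:~R| -> theta <= `|u k| \/ theta <= `|v k|.
  pose z := k%:~R / eta%:R `^ alpha.
  have theta_le w : delta * Gamma < `|w| -> theta <= `|w * eta%:R `^ beta|.
    by move=> h; rewrite normrM (gtr0_norm etab_gt0) /theta /t mulrA ler_pM2r// ltW.
  have pos w : delta * Gamma < w -> delta * Gamma < `|w|.
    by move/lt_le_trans; apply; rewrite ler_norm.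
  have neg w : w < - (delta * Gamma) -> delta * Gamma < `|w|.
    by rewrite ltrNr => /lt_le_trans; apply; rewrite -normrN ler_norm.
  rewrite /x1 -ltr_pdivlMr// -[X in _ / X](gtr0_norm etaa_gt0) -normfV -normrM -/z.
  rewrite ltr_normr => /orP[/far_pos|]; last first.
    rewrite ltrNr => /far_neg.
    by case=> [/pos|/neg] /theta_le; [left|right].
  by case=> [/neg|/pos] /theta_le; [left|right].
have := symmetric_profit_loss_ge n0 (y_matching eta) L_gt0 t_gt0 tL1 u_le v_le statpi' e_le
  eta_gt0 erefl (ltW a_gt0) x1_ge0 theta_ge0 local (fluid_valueE opt) far x1_le.
rewrite -lamE -muE => loss_ge.
(* [Gamma], which may depend on [n], and [beta] enter only through [t], so a bound uniform in [t]
   removes them. *)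
have amgm : c0 `^ 3^-1 * n%:R `^ 3^-1 * eta%:R `^ 3^-1 <=
    n%:R * a * theta ^+ 2 / (2 * eta%:R) + L / (32 * t).
  have := @cube_amgm _ (n%:R * a * delta ^+ 2 / (2 * eta%:R)) (L / 32) t
    (c0 `^ 3^-1 * n%:R `^ 3^-1 * eta%:R `^ 3^-1).
  rewrite (_ : _ * t ^+ 2 + _ = n%:R * a * theta ^+ 2 / (2 * eta%:R) + L / (32 * t)); last first.
    by rewrite /theta; field; rewrite !gt_eqF.
  apply=> //.
  - by rewrite divr_ge0 ?mulr_ge0 ?sqr_ge0// ltW.
  - by rewrite divr_ge0// ltW.
  - by rewrite !mulr_ge0 ?powR_ge0.
  rewrite !exprMn !powR_cbrtK ?(ltW c0_gt0)// /c0 /L; field.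
  by rewrite gt_eqF.
have r0 : 0 < eta%:R `^ 3^-1 :> R by rewrite powR_gt0.
apply: (@le_trans _ _ ((c0 `^ 3^-1 * n%:R `^ 3^-1 * eta%:R `^ 3^-1)%:E
    * ((eta%:R `^ 3^-1)^-1)%:E)%E).
  by rewrite -EFinM mulfK// gt_eqF.
apply: lee_wpmul2r; first by rewrite lee_fin invr_ge0 ltW.
by apply: le_trans loss_ge; rewrite lee_fin.
Unshelve. all: by end_near.
Qed.
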